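(* For $a,b\in\mathbb{Z}\setminus\{0\}$, $$\mathcal{P}\bigl(x(ax+1),\,x(bx+1)\bigr)\quad\Longleftrightarrow\quad \gcd(|a|,|b|)=1\ \text{ and }\ a\neq b.$$
   Context: $\mathbb{N}=\{1,2,\ldots\}$. For $A\subset\mathbb{N}$ and $m\in\mathbb{Z}$, put $d_A(m)=\#\{a\in A: a\mid m\}$, which may be infinite (in particular $d_A(0)=|A|$). For $u,v\in\mathbb{Z}$ define $\delta_A(u,v)=0$ if $u=v=0$; $\delta_A(u,v)=\infty$ if exactly one of $u,v$ is zero; $\delta_A(u,v)=|d_A(u)-d_A(v)|$ if $uv\neq 0$. For $F,G\in\mathbb{Z}[x]$, $\mathcal{P}(F,G)$ denotes the property: for every infinite $A\subset\mathbb{N}$, $\limsup_{n\to\infty}\delta_A(F(n),G(n))=\infty$ ($n$ running over positive integers). *)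

(* Defs.v *)
From HB Require Import structures.
From mathcomp Require Import all_boot all_order all_algebra.
From mathcomp Require Import all_classical all_reals all_analysis.

Set Implicit Arguments.
Unset Strict Implicit.
Unset Printing Implicit Defensive.

Import Order.TTheory GRing.Theory Num.Theory.

Local Open Scope classical_set_scope.
Local Open Scope ring_scope.

(* [counting] is the cardinality of a finite set and +oo on an infinite set.
   The set of positive integers is represented inside [nat], so positivity of
   the elements of [A] is a hypothesis wherever it is needed. *)
Definition divisor_count (R : realType) (A : set nat) (m : int) : \bar R :=
  counting [set a : nat | A a /\ (a%:Z %| m)%Z].

(* In the last branch both counts are finite, provided that 0 is not in [A]. *)
Definition divisor_gap (R : realType) (A : set nat) (u v : int) : \bar R :=
  if (u == 0) && (v == 0) then 0%E
  else if (u == 0) || (v == 0) then +oo%E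
  else `|divisor_count R A u - divisor_count R A v|%E.

(* The sequence is indexed by [nat]; [n.+1] runs over the positive integers. *)
Definition unbounded_divisor_gap (R : realType) (F G : {poly int}) : Prop :=
  forall A : set nat,
    A `<=` [set a : nat | (0 < a)%N] -> infinite_set A ->
    limn_esup (fun n : nat =>
      divisor_gap R A F.[n.+1%:Z] G.[n.+1%:Z]) = +oo%E.

(* Main.v *)
Require Import Defs.
From mathcomp Require Import all_boot all_order all_algebra.
From mathcomp Require Import all_classical all_reals all_analysis.
From mathcomp Require Import ring lra zify.

(** Write F(n) = n (a n + 1) and G(n) = n (b n + 1).

    If a = b the gap is identically zero.  If a prime p divides both a and b,
    take for A the powers of p: as a n + 1 and b n + 1 are prime to p, a power
    of p divides F(n) iff it divides n iff it divides G(n), and the gap is zero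
    again.

    Now let a and b be coprime and distinct, and let A be infinite.  The task
    is to find arbitrarily large n such that many elements of A divide one of
    F(n), G(n) while a bounded number divide the other.

    Suppose first that only finitely many elements of A are prime to a.  Given
    any finite part of A, the Chinese remainder theorem yields n such that all
    its elements divide G(n) and F(n) is prime to a (multiples_avoiding); then
    the number of elements of A dividing F(n) is bounded.

    Suppose next that infinitely many elements of A are prime to a.  Any
    finite number of them divide a n + 1 for n in a suitable progression, which
    can be chosen such that the part of G(n) at the primes of the modulus
    divides 2 (a - b).  It remains to bound the number of divisors of
    the rest of G(n) independently of the modulus (values_few_divisors).  This is a
    sieve problem: one needs K such that every admissible progression contains
    n for which the primes of G(n) outside the modulus all exceed some Z while
    |G(n)| < Z ^ K (almost_prime_values).

    That statement is proved by the Brun-Hooley sieve.  The primes up to Z are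
    cut into blocks from x to x ^ 2.  Inside a block the condition of having no
    prime factor there is replaced by inclusion-exclusion truncated according
    to the Bonferroni inequalities (bonferroni), and the blocks are combined
    into a lower bound for the indicator of having no small prime factor
    (blocks_sound, blocks_lower_main).  The result is a multilinear polynomial
    in divisibility indicators, whose average over a progression is its value at
    the densities 2 / p up to an error controlled by its coefficients
    (multilinear_count, block_norm_bound).  Chebyshev's bound
    (primes_dyadic_count) shows that the densities over a block have bounded
    sum and that the product of their complements is bounded below
    (prime_block_sum, prime_block_prod), so that the main term wins. *)

Set Implicit Arguments.
Unset Strict Implicit.
Unset Printing Implicit Defensive.
Import Order.TTheory GRing.Theory Num.Theory.
Local Open Scope ring_scope.

(** * Truncated inclusion-exclusion *)

Fixpoint esym (R : pzRingType) (I : Type) (x : I -> R) (s : seq I) (n : nat) : R :=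
  if s is p :: s' then
    esym x s' n + (if n is m.+1 then x p * esym x s' m else 0)
  else (n == 0%N)%:R.

(** The partial sums of the expansion of the product of the 1 - x p, that is,
    of inclusion-exclusion when x is an indicator. *)
Definition bonf (R : pzRingType) (I : Type) (x : I -> R) (s : seq I) (b : nat) : R :=
  \sum_(j < b.+1) (-1) ^+ j * esym x s j.

Lemma esym0 (R : pzRingType) (I : Type) (x : I -> R) (s : seq I) : esym x s 0 = 1.
Proof. by elim: s => //= p s ->; rewrite addr0. Qed.

Lemma esym_ge0 (R : realDomainType) (I : Type) (x : I -> R) (s : seq I) (n : nat) :
  (forall p, 0 <= x p) -> 0 <= esym x s n.
Proof.
move=> x0; elim: s n => [|p s IH] [|n] //=; first by rewrite addr0.
by rewrite addr_ge0 // mulr_ge0.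
Qed.

Lemma bonf0 (R : pzRingType) (I : Type) (x : I -> R) (s : seq I) : bonf x s 0 = 1.
Proof. by rewrite /bonf big_ord1 esym0 mulr1. Qed.

Lemma bonfS (R : pzRingType) (I : Type) (x : I -> R) (s : seq I) (b : nat) :
  bonf x s b.+1 = bonf x s b + (-1) ^+ b.+1 * esym x s b.+1.
Proof. by rewrite /bonf big_ord_recr. Qed.

Lemma bonf_cons (R : comNzRingType) (I : Type) (x : I -> R) p (s : seq I) (b : nat) :
  bonf x (p :: s) b.+1 = bonf x s b.+1 - x p * bonf x s b.
Proof.
elim: b => [|b IH]; first by rewrite !bonfS !bonf0 !expr1 /= esym0; ring.
by rewrite bonfS IH !(bonfS x s) /= !exprS; ring.
Qed.

(** Partial sums lie alternately above and below the full product.  Adding one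
    element replaces the error of order b.+1 by itself minus x p times the
    error of order b, and these two have opposite signs.  Stated for arbitrary
    weights in [0, 1], this covers both the indicators at a given integer and
    the densities of the corresponding residue classes. *)
Lemma bonferroni (R : realDomainType) (I : Type) (x : I -> R) (s : seq I) (b : nat) :
  (forall p, 0 <= x p <= 1) ->
  0 <= (-1) ^+ b * (bonf x s b - \prod_(p <- s) (1 - x p)).
Proof.
move=> x01.
elim: s b => [|p s IH] b.
  rewrite big_nil [X in X - 1](_ : _ = 1) ?subrr ?mulr0 //.
  by rewrite /bonf big_ord_recl /= big1 ?addr0 ?mulr1 // => i _; rewrite mulr0.
case: b => [|b]; last first.
  rewrite bonf_cons big_cons.
  have /andP[xp _] := x01 p.
  have H := mulr_ge0 xp (IH b); have H1 := IH b.+1.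
  have -> : forall B B' V : R, (-1) ^+ b.+1 * (B' - x p * B - (1 - x p) * V) =
    (-1) ^+ b.+1 * (B' - V) + x p * ((-1) ^+ b * (B - V)) by move=> *; rewrite exprS; ring.
  exact: addr_ge0.
rewrite bonf0 expr0 mul1r subr_ge0 prodr_ile1 // => i _.
have := x01 i; lra.
Qed.

Lemma bonf_even_ge (R : realDomainType) (I : Type) (x : I -> R) (s : seq I) (k : nat) :
  (forall p, 0 <= x p <= 1) ->
  \prod_(p <- s) (1 - x p) <= bonf x s (2 * k).
Proof.
by move=> /(@bonferroni _ _ x s (2 * k)); rewrite exprM sqrrN !expr1n mul1r subr_ge0.
Qed.

Lemma bonf_even_sub_le (R : realDomainType) (I : Type) (x : I -> R) (s : seq I) (k : nat) :
  (forall p, 0 <= x p <= 1) ->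
  bonf x s (2 * k) - esym x s (2 * k).+1 <= \prod_(p <- s) (1 - x p).
Proof.
move=> /(@bonferroni _ _ x s (2 * k).+1); rewrite bonfS exprS exprM sqrrN !expr1n; lra.
Qed.

(** Expanding the power of the sum, every product of n distinct weights occurs
    with multiplicity n!. *)
Lemma esym_le_fact (R : realFieldType) (I : Type) (x : I -> R) (s : seq I) (n : nat) :
  (forall p, 0 <= x p) ->
  esym x s n * n`!%:R <= (\sum_(p <- s) x p) ^+ n.
Proof.
move=> x0; elim: s n => [|p s IH] [|n] /=; rewrite ?esym0 ?addr0 ?mul1r //.
- by rewrite big_nil mul0r exprS mul0r.
rewrite big_cons; set S := \sum_(_ <- s) _.
have S0 : 0 <= S by rewrite sumr_ge0.
have H1 : n.+1%:R * x p * (esym x s n * n`!%:R) <= n.+1%:R * x p * S ^+ n.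
  by rewrite ler_wpM2l // mulr_ge0.
have H2 := IH n.+1.
have H3 : S ^+ n.+1 + n.+1%:R * x p * S ^+ n <= (x p + S) ^+ n.+1.
  rewrite exprDn !big_ord_recr /= subnn subSnn !binn binSn.
  have : 0 <= \sum_(i < n) x p ^+ (n.+1 - i) * S ^+ i *+ 'C(n.+1, i).
    by apply: sumr_ge0 => i _; rewrite mulrn_wge0 // mulr_ge0 ?exprn_ge0.
  have -> : x p ^+ 1 * S ^+ n *+ n.+1 = n.+1%:R * x p * S ^+ n by rewrite -mulr_natl expr1 mulrA.
  rewrite expr0 mul1r; lra.
rewrite factS natrM in H2 *; lra.
Qed.

(** Brun-Hooley sieve: the indicator of having no prime factor in any block is
    a product over the blocks, and each factor is replaced by a truncation of
    its own.  Even truncations give an upper bound at once. *)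
Definition blocks_upper (R : pzRingType) (ps : nat -> seq nat) (k : nat -> nat)
    (i : nat) (x : nat -> R) : R :=
  \prod_(l < i) bonf x (ps l) (2 * k l).

(** For a lower bound, one factor at a time is lowered by the next symmetric
    function, while the other factors stay at their upper bounds. *)
Fixpoint blocks_lower (R : pzRingType) (ps : nat -> seq nat) (k : nat -> nat)
    (i : nat) (x : nat -> R) : R :=
  if i is j.+1 then
    blocks_lower ps k j x * bonf x (ps j) (2 * k j)
    - blocks_upper ps k j x * esym x (ps j) (2 * k j).+1
  else 1.

Lemma blocks_upperS (R : pzRingType) (ps : nat -> seq nat) (k : nat -> nat)
    (i : nat) (x : nat -> R) :
  blocks_upper ps k i.+1 x = blocks_upper ps k i x * bonf x (ps i) (2 * k i).
Proof. by rewrite /blocks_upper big_ord_recr. Qed.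

(** For the lower bound, let V be the product over the earlier blocks, L and U
    its bounds, v the product over the next block, B and e the truncation and
    the next symmetric function there.  As V <= U and B, e >= 0, one has
    L B - U e <= V (B - e), and B - e <= v by the odd Bonferroni inequality. *)
Lemma blocks_sound (R : realDomainType) (ps : nat -> seq nat) (k : nat -> nat)
    (i : nat) (x : nat -> R) :
  (forall p, 0 <= x p <= 1) ->
  0 <= \prod_(l < i) \prod_(p <- ps l) (1 - x p) <= blocks_upper ps k i x /\
  blocks_lower ps k i x <= \prod_(l < i) \prod_(p <- ps l) (1 - x p).
Proof.
move=> x01; elim: i => [|i [/andP[IH0 IH1] IH2]].
  by rewrite /blocks_upper !big_ord0 /= ler01 lexx.
rewrite blocks_upperS !big_ord_recr /=.
set V := \prod_(l < i) _ in IH0 IH1 IH2 *; set v := \prod_(p <- ps i) _.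
have v0 : 0 <= v by apply: prodr_ge0 => p; have := x01 p; lra.
have hb := bonf_even_ge (ps i) (k i) x01; have hb' := bonf_even_sub_le (ps i) (k i) x01.
rewrite -/v in hb hb'.
have e0 : 0 <= esym x (ps i) (2 * k i).+1.
  by apply: esym_ge0 => p; have /andP[] := x01 p.
split; first by rewrite mulr_ge0 //= ler_pM.
set B := bonf _ _ _ in hb hb' *; set e := esym _ _ _ in hb' e0 *.
set U := blocks_upper _ _ _ _ in IH1 *.
set L := blocks_lower _ _ _ _ in IH2 *.
have B0 := le_trans v0 hb.
have h1 : L * B <= V * B by rewrite ler_wpM2r.
have h2 : V * e <= U * e by rewrite ler_wpM2r.
have h3 : V * (B - e) <= V * v by rewrite ler_wpM2l.
rewrite mulrBr in h3; lra.
Qed.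

(** If the correction in block l is at most eps l times the product of that
    block, the lower bound loses only the proportion sum eps of the upper. *)
Lemma blocks_lower_main (R : realDomainType) (ps : nat -> seq nat) (k : nat -> nat)
    (eps : nat -> R) i (x : nat -> R) :
  (forall p, 0 <= x p <= 1) ->
  (forall l, (l < i)%N -> esym x (ps l) (2 * k l).+1 <= eps l * \prod_(p <- ps l) (1 - x p)) ->
  (forall l, 0 <= eps l) ->
  (1 - \sum_(l < i) eps l) * blocks_upper ps k i x <= blocks_lower ps k i x.
Proof.
move=> x01 + eps0; elim: i => [|i IH] H.
  by rewrite /blocks_upper !big_ord0 /= subr0 mulr1.
rewrite blocks_upperS /= big_ord_recr /=.
have {}IH := IH (fun l hl => H l (ltnW hl)).
have {}H := H i (ltnSn i).
have hb := bonf_even_ge (ps i) (k i) x01.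
have [/andP[V0 VU] _] := blocks_sound ps k i x01.
have U0 := le_trans V0 VU.
set B := bonf _ _ _ in hb *; set e := esym _ _ _ in H *.
set U := blocks_upper _ _ _ _ in IH U0 *.
set L := blocks_lower _ _ _ _ in IH *.
set v := \prod_(p <- ps i) _ in H hb.
have v0 : 0 <= v by apply: prodr_ge0 => p; have := x01 p; lra.
have h1 : U * e <= U * (eps i * B).
  by rewrite ler_wpM2l // (le_trans H) // ler_wpM2l.
have h2 : (1 - \sum_(l < i) eps l) * U * B <= L * B.
  by rewrite ler_wpM2r // (le_trans v0).
lra.
Qed.

(** * Multilinear functions of divisibility indicators *)

(** A multilinear polynomial is given by a list of coefficients, each with the
    duplicate-free list of its variables.  Its norm charges 4 per variable:
    averaging the indicator monomial of k primes over a progression costs an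
    error of at most 4 ^ k, so N bounds the error made in averaging f. *)
Definition multilinear (P : nat -> Prop) (f : (nat -> rat) -> rat) (N : rat) : Prop :=
  exists l : seq (rat * seq nat),
  [/\ forall x, f x = \sum_(m <- l) m.1 * \prod_(p <- m.2) x p,
      \sum_(m <- l) `|m.1| * 4 ^+ size m.2 <= N
    & forall m, m \in l -> uniq m.2 /\ forall p, p \in m.2 -> P p].

Lemma multilinear_sub (P Q : nat -> Prop) f g (N N' : rat) :
  (forall p, P p -> Q p) -> f =1 g -> N <= N' ->
  multilinear P f N -> multilinear Q g N'.
Proof.
move=> PQ fg NN' [l [lf lN lu]]; exists l; split.
- by move=> x; rewrite -fg.
- exact: le_trans NN'.
- by move=> m /lu [mu mP]; split => // p /mP /PQ.
Qed.

Lemma multilinear_cst (P : nat -> Prop) (c : rat) : multilinear P (fun=> c) `|c|.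
Proof.
exists [:: (c, [::])]; split.
- by move=> x; rewrite big_seq1 big_nil mulr1.
- by rewrite big_seq1 mulr1.
- by move=> m; rewrite inE => /eqP ->.
Qed.

Lemma multilinear_var (p : nat) : multilinear (eq p) (fun x => x p) 4.
Proof.
exists [:: (1, [:: p])]; split.
- by move=> x; rewrite !big_seq1 mul1r.
- by rewrite big_seq1 normr1 mul1r.
- by move=> m; rewrite inE => /eqP -> /=; split => // q; rewrite inE => /eqP.
Qed.

Lemma multilinearD (P : nat -> Prop) f g (M N : rat) :
  multilinear P f M -> multilinear P g N ->
  multilinear P (fun x => f x + g x) (M + N).
Proof.
move=> [l [lf lN lu]] [k [kf kN ku]]; exists (l ++ k); split.
- by move=> x; rewrite big_cat /= lf kf.
- by rewrite big_cat lerD.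
- by move=> m; rewrite mem_cat => /orP[/lu|/ku].
Qed.

Lemma multilinearM (P Q : nat -> Prop) f g (M N : rat) :
  (forall p, P p -> Q p -> False) ->
  multilinear P f M -> multilinear Q g N ->
  multilinear (fun p => P p \/ Q p) (fun x => f x * g x) (M * N).
Proof.
move=> PQ [l [lf lN lu]] [k [kf kN ku]].
exists [seq (u.1 * v.1, u.2 ++ v.2) | u <- l, v <- k]; split.
- move=> x; rewrite lf kf big_distrlr big_allpairs_dep /=.
  by do 2!apply: eq_bigr => ? _; rewrite big_cat mulrACA.
- rewrite big_allpairs_dep /=.
  rewrite (eq_bigr (fun u : rat * seq nat =>
    `|u.1| * 4 ^+ size u.2 * \sum_(v <- k) `|v.1| * 4 ^+ size v.2)); last first.
    move=> u _; rewrite mulr_sumr; apply: eq_bigr => v _.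
    by rewrite normrM size_cat exprD mulrACA.
  have pos (s : seq (rat * seq nat)) : 0 <= \sum_(v <- s) `|v.1| * 4 ^+ size v.2.
    by apply: sumr_ge0 => v _; rewrite mulr_ge0 // exprn_ge0.
  by rewrite -mulr_suml ler_pM.
- move=> m /allpairsP [[u v] /= [ul vk ->]] /=.
  have [uu uP] := lu u ul; have [vu vQ] := ku v vk; split.
    rewrite cat_uniq uu vu andbT; apply/hasPn => p pv; apply/negP => pu.
    exact: (PQ p (uP p pu) (vQ p pv)).
  by move=> p; rewrite mem_cat => /orP[/uP|/vQ]; [left|right].
Qed.

Lemma multilinearZ (P : nat -> Prop) f (c N : rat) :
  multilinear P f N -> multilinear P (fun x => c * f x) (`|c| * N).
Proof.
move=> h; apply: (multilinear_sub _ _ _ (multilinearM (P := fun=> False) _ (multilinear_cst _ c) h)) => //.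
by move=> p [].
Qed.

(** Each new element adds the monomials that contain it, at cost 4 each; this is
    the first two terms of the binomial expansion of (4 (k + 1)) ^ n. *)
Lemma multilinear_esym (s : seq nat) (n : nat) : uniq s ->
  multilinear (fun p => p \in s) (fun x => esym x s n) ((4 * (size s)%:R) ^+ n).
Proof.
elim: s n => [|p s IH] [|n] /=.
- by move=> _; have := multilinear_cst (fun p => p \in [::]) 1; rewrite normr1.
- move=> _; have := multilinear_cst (fun p => p \in [::]) 0; rewrite normr0.
  by apply: multilinear_sub => // *; rewrite mulr0 exprS mul0r.
- move=> _; have := multilinear_cst (fun q => q \in p :: s) 1; rewrite normr1.
  by apply: multilinear_sub => // x; rewrite esym0 addr0.
move=> /andP[ps us].
have h1 : multilinear (fun q => q \in p :: s) (fun x => esym x s n.+1) ((4 * (size s)%:R) ^+ n.+1).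
  by apply: multilinear_sub (IH n.+1 us) => // q; rewrite inE => ->; rewrite orbT.
have h2 : multilinear (fun q => q \in p :: s) (fun x => x p * esym x s n) (4 * (4 * (size s)%:R) ^+ n).
  apply: multilinear_sub (multilinearM _ (multilinear_var p) (IH n us)) => //.
    by move=> q [->|]; rewrite inE ?eqxx // => ->; rewrite orbT.
  by move=> q <-; rewrite (negPf ps).
apply: multilinear_sub (multilinearD h1 h2) => //.
rewrite exprS -mulrDl (_ : 4 * _ + 4 = 4 * (size s).+1%:R); last by rewrite -natr1; ring.
rewrite [leRHS]exprS ler_wpM2l // lerXn2r ?nnegrE //.
by rewrite ler_wpM2l // ler_nat.
Qed.

Lemma multilinear_bonf (s : seq nat) (b : nat) (W : rat) : uniq s ->
  4 * (size s)%:R <= W -> 2 <= W ->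
  multilinear (fun p => p \in s) (fun x => bonf x s b) (W ^+ b.+1).
Proof.
move=> us sW W2; elim: b => [|b IH].
  have := multilinear_cst (fun q => q \in s) 1; rewrite normr1.
  by apply: multilinear_sub => // [x|]; rewrite ?bonf0 // expr1; lra.
have h := multilinearZ ((-1) ^+ b.+1) (multilinear_esym b.+1 us).
apply: multilinear_sub (multilinearD IH h) => // [x|]; first by rewrite bonfS.
rewrite normrX normrN1 expr1n mul1r.
have : (4 * (size s)%:R) ^+ b.+1 <= W ^+ b.+1 by rewrite lerXn2r ?nnegrE //; lra.
have : 2 * W ^+ b.+1 <= W * W ^+ b.+1 by rewrite ler_wpM2r // exprn_ge0 //; lra.
rewrite (exprS W b.+1); lra.
Qed.

(** The same bound serves for the upper and the lower sieve function, so the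
    recursion defining the latter at most doubles it in every block. *)
Lemma multilinear_blocks (ps : nat -> seq nat) (k : nat -> nat) (W : nat -> rat) (i : nat) :
  (forall l, uniq (ps l)) ->
  (forall l l' p, p \in ps l -> p \in ps l' -> l = l') ->
  (forall l, 4 * (size (ps l))%:R <= W l) -> (forall l, 2 <= W l) ->
  multilinear (fun p => exists2 l, (l < i)%N & p \in ps l) (blocks_upper ps k i)
    (\prod_(l < i) (2 * W l ^+ (2 * k l).+2)) /\
  multilinear (fun p => exists2 l, (l < i)%N & p \in ps l) (blocks_lower ps k i)
    (\prod_(l < i) (2 * W l ^+ (2 * k l).+2)).
Proof.
move=> ups dps szW W2; elim: i => [|i [IHu IHl]].
  have h := multilinear_cst (fun p => exists2 l, (l < 0)%N & p \in ps l) 1; rewrite normr1 in h.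
  split; apply: multilinear_sub h => //; rewrite /blocks_upper ?big_ord0 //.
  by move=> x; rewrite big_ord0.
rewrite big_ord_recr /=; set X := \prod_(l < i) _ in IHu IHl *.
have X0 : 0 <= X.
  by apply: prodr_ge0 => l _; rewrite mulr_ge0 // exprn_ge0 //; have := W2 l; lra.
have W0 : 0 <= W i by have := W2 i; lra.
have disj p : (exists2 l, (l < i)%N & p \in ps l) -> p \in ps i -> False.
  by move=> [l li pl] /(dps _ _ _ pl) lE; move: li; rewrite lE ltnn.
have sub p : (exists2 l, (l < i)%N & p \in ps l) \/ p \in ps i ->
    exists2 l, (l < i.+1)%N & p \in ps l.
  by move=> [[l li pl]|pi]; [exists l => //; apply: ltnW|exists i].
have hb := multilinear_bonf (2 * k i) (ups i) (szW i) (W2 i).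
have he := multilinear_esym (2 * k i).+1 (ups i).
have WW : W i ^+ (2 * k i).+1 <= W i ^+ (2 * k i).+2.
  by rewrite ler_eXn2l //; have := W2 i; lra.
have W1 : 0 <= W i ^+ (2 * k i).+2 by rewrite exprn_ge0.
have eW : (4 * (size (ps i))%:R) ^+ (2 * k i).+1 <= W i ^+ (2 * k i).+2.
  by apply: le_trans WW; rewrite lerXn2r ?nnegrE.
have XW : 0 <= X * W i ^+ (2 * k i).+2 by rewrite mulr_ge0.
split.
  apply: multilinear_sub (multilinearM disj IHu hb) => //.
    by move=> x; rewrite blocks_upperS.
  by rewrite ler_wpM2l //; lra.
have h1 := multilinearM disj IHl hb.
have h2 := multilinearZ (-1) (multilinearM disj IHu he).
apply: multilinear_sub (multilinearD h1 h2) => //.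
  by move=> x /=; rewrite mulN1r.
rewrite normrN1 mul1r -mulrDr ler_wpM2l //; lra.
Qed.
(** * Averaging over an arithmetic progression *)

Definition root_ind (b : int) (n p : nat) : rat := ((p%:Z %| n%:Z * (b * n%:Z + 1))%Z)%:R.

(** Of the p residue classes modulo p, two are roots of n (b n + 1) when p does
    not divide b.  The value 0 off the primes keeps the weight within [0, 1]. *)
Definition root_density (p : nat) : rat := if prime p then 2 / p%:R else 0.

Lemma sum_modn_eq (f : nat -> rat) (p c T : nat) : (c < p)%N ->
  \sum_(t < T | (t %% p == c)%N) f t =
  \sum_(u < (T + (p - 1 - c)) %/ p) f (c + p * u)%N.
Proof.
move=> cp; elim: T => [|T IH].
  by rewrite big_ord0 divn_small ?big_ord0 //; lia.
rewrite big_mkcond big_ord_recr /= -big_mkcond IH.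
have p0 : (0 < p)%N by lia.
have divE x q : (q * p <= x < q.+1 * p)%N -> (x %/ p = q)%N.
  move=> /andP[h1 h2]; apply/eqP; rewrite eqn_leq leq_divRL // h1 andbT.
  by rewrite -ltnS ltn_divLR.
have := divn_eq T p; have := ltn_mod T p; rewrite p0.
set q := (T %/ p)%N; set m := (T %% p)%N => mp TE.
case: (ltngtP m c) => mc.
- by rewrite !(divE _ q) ?addr0 //; nia.
- by rewrite !(divE _ q.+1) ?addr0 //; nia.
rewrite (divE _ q); last nia.
rewrite (divE (T.+1 + _)%N q.+1); last nia.
by rewrite big_ord_recr /= TE mc mulnC addnC.
Qed.

(** Modulo p, the roots of n (b n + 1) are 0 and - 1 / b; they are pulled back
    along the bijection t |-> r + M t. *)
Lemma root_ind_classes (b : int) (r M p : nat) :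
  prime p -> ~~ (p %| M)%N -> ~~ (p %| `|b|)%N ->
  exists c1 c2, [/\ (c1 < p)%N, (c2 < p)%N &
    forall t, root_ind b (r + M * t) p = (t %% p == c1)%N%:R + (t %% p == c2)%N%:R].
Proof.
move=> pp pM pb.
have M0 : (M%:R : 'F_p) != 0 by rewrite -(dvdn_pcharf (pchar_Fp pp)).
have b0 : (b%:~R : 'F_p) != 0 by rewrite -(dvdz_pcharf (pchar_Fp pp)) dvdzE.
pose x1 : 'F_p := - r%:R / M%:R; pose x2 : 'F_p := (- (b%:~R)^-1 - r%:R) / M%:R.
have xltp (x : 'F_p) : (x < p)%N by rewrite -[X in (_ < X)%N](Fp_cast pp).
have natE t (x : 'F_p) : (t %% p == x)%N = (t%:R == x).
  by rewrite -val_eqE /= val_Fp_nat.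
exists x1, x2; split=> // t; rewrite !natE /root_ind (dvdz_pcharf (pchar_Fp pp)).
rewrite !(intrM, intrD) -!pmulrn natrD natrM mulf_eq0.
set y : 'F_p := t%:R.
have -> : (r%:R + M%:R * y == 0) = (y == x1).
  apply/eqP/eqP => [h|->]; last by rewrite /x1; field.
  by rewrite /x1; apply: (mulfI M0); rewrite [RHS]mulrC divfK //; apply: (addrI r%:R); rewrite h; ring.
have -> : (b%:~R * (r%:R + M%:R * y) + 1 == 0) = (y == x2).
  apply/eqP/eqP => [h|->]; last by rewrite /x2; field; rewrite b0 M0.
  rewrite /x2; apply: (mulfI M0); rewrite [RHS]mulrC divfK //.
  apply: (mulfI b0); rewrite mulrBr mulrN divff //.
  have -> : b%:~R * (M%:R * y) = b%:~R * (r%:R + M%:R * y) + 1 - 1 - b%:~R * r%:R by ring.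
  by rewrite h; ring.
have x12 : x1 != x2.
  rewrite /x1 /x2; apply/eqP => /(mulIf (invr_neq0 M0)) h.
  have : (b%:~R : 'F_p)^-1 = - r%:R - (- (b%:~R)^-1 - r%:R) by ring.
  by rewrite -h subrr => /eqP; rewrite invr_eq0 (negPf b0).
by case: eqP => [->|_] /=; rewrite ?(negPf x12) ?addr0 ?add0r.
Qed.

(** The condition at p selects two residue classes of t, on each of which the
    other primes are counted along a progression of modulus M p.  Rounding
    T / p changes the main term of either by at most 1, so the error E k for k
    primes obeys E (k + 1) <= 2 (E k + 1), whence the generous 4 ^ k. *)
Lemma root_ind_count (b : int) (r M T : nat) (s : seq nat) :
  uniq s -> (forall p, p \in s -> [/\ prime p, ~~ (p %| M)%N & ~~ (p %| `|b|)%N]) ->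
  `|\sum_(t < T) \prod_(p <- s) root_ind b (r + M * t) p
     - T%:R * \prod_(p <- s) (2 / p%:R)| <= 4 ^+ size s.
Proof.
elim: s r M T => [|p s IH] r M T.
  move=> _ _; rewrite big_nil; under eq_bigr do rewrite big_nil.
  by rewrite sumr_const card_ord mulr1 subrr normr0 expr0.
move=> /= /andP[ps us] hs.
have [pp pM pb] := hs p (mem_head _ _).
have [c1 [c2 [c1p c2p cE]]] := root_ind_classes r pp pM pb.
have p2 : (2 <= p%:R :> rat) by rewrite (ler_nat _ 2) prime_gt1.
have p0 : (0 < p%:R :> rat) by lra.
set G := \prod_(q <- s) (2 / q%:R : rat).
have G01 : 0 <= G <= 1.
  rewrite /G big_seq; apply/andP; split.
    by apply: prodr_ge0 => q _; rewrite divr_ge0.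
  apply: prodr_ile1 => q /(fun h => hs q (mem_behead (s := p :: s) h)) [qp _ _].
  rewrite divr_ge0 //= ler_pdivrMr ?ltr0n ?prime_gt0 // mul1r.
  by rewrite (ler_nat _ 2) prime_gt1.
have part c : (c < p)%N ->
    `|\sum_(t < T | (t %% p == c)%N) \prod_(q <- s) root_ind b (r + M * t) q
     - T%:R / p%:R * G| <= 4 ^+ size s + 1.
  move=> cp; rewrite (sum_modn_eq (fun t => \prod_(q <- s) root_ind b (r + M * t) q)) //.
  set T' := ((T + (p - 1 - c)) %/ p)%N.
  have h : `|T'%:R - T%:R / p%:R : rat| <= 1.
    have h1 : (T' * p <= T + p)%N.
      by apply: leq_trans (leq_trunc_div _ _) _; rewrite leq_add2l; lia.
    have h2 : (T <= T' * p + p)%N.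
      have := ltn_ceil (T + (p - 1 - c)) (prime_gt0 pp); rewrite -/T'.
      by move: (prime_gt0 pp) => ?; nia.
    move: h1 h2; rewrite -!(ler_nat rat) !natrD !natrM => h1 h2.
    have E : ((T'%:R - T%:R / p%:R) * p%:R : rat) = T'%:R * p%:R - T%:R by field; lra.
    rewrite -(ler_pM2r p0) mul1r -[X in _ * X](gtr0_norm p0) -normrM E.
    by rewrite ler_norml; lra.
  have := IH (r + M * c)%N (M * p)%N T' us; rewrite -/G.
  have hs' : forall q, q \in s -> [/\ prime q, ~~ (q %| M * p)%N & ~~ (q %| `|b|)%N].
    move=> q qs; have [qp qM qb] := hs q (mem_behead (s := p :: s) qs).
    split => //; rewrite Euclid_dvdM // (negPf qM) /= dvdn_prime2 //.
    by apply: contraNneq ps => <-.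
  move=> /(_ hs'); under eq_bigr do rewrite -addnA -mulnA -mulnDr.
  set S := \sum_(i < T') _ => hS.
  have -> : S - T%:R / p%:R * G = (S - T'%:R * G) + (T'%:R - T%:R / p%:R) * G by ring.
  apply: le_trans (ler_normD _ _) _; rewrite lerD // normrM -[leRHS]mulr1.
  by rewrite ler_pM // ger0_norm; lra.
rewrite big_cons.
under eq_bigr do rewrite big_cons cE mulrDl.
rewrite big_split /=.
have cond c : \sum_(t < T) (t %% p == c)%N%:R * \prod_(q <- s) root_ind b (r + M * t) q =
   \sum_(t < T | (t %% p == c)%N) \prod_(q <- s) root_ind b (r + M * t) q.
  rewrite [RHS]big_mkcond; apply: eq_bigr => t _.
  by case: (_ == c)%N; rewrite ?mul1r ?mul0r.
rewrite !cond; have := part c1 c1p; have := part c2 c2p.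
set S1 := \sum_(t < T | (t %% p == c1)%N) _; set S2 := \sum_(t < T | _) _ => h2 h1.
have -> : S1 + S2 - T%:R * (2 / p%:R * G) =
   (S1 - T%:R / p%:R * G) + (S2 - T%:R / p%:R * G) by field; lra.
apply: le_trans (ler_normD _ _) _.
have : 1 <= (4 : rat) ^+ size s by rewrite exprn_ege1.
rewrite exprS; lra.
Qed.

Lemma multilinear_count (b : int) (r M T : nat) (P : nat -> Prop) f (N : rat) :
  multilinear P f N ->
  (forall p, P p -> [/\ prime p, ~~ (p %| M)%N & ~~ (p %| `|b|)%N]) ->
  `|\sum_(t < T) f (root_ind b (r + M * t)) - T%:R * f root_density| <= N.
Proof.
move=> [l [lf lN lu]] hP; apply: le_trans lN.
under eq_bigr do rewrite lf.
rewrite exchange_big lf mulr_sumr -sumrB.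
apply: le_trans (ler_norm_sum _ _ _) _.
rewrite big_seq [leRHS]big_seq; apply: ler_sum => m ml.
have [mu mP] := lu m ml.
rewrite -mulr_sumr mulrCA -mulrBr normrM ler_wpM2l //.
rewrite (_ : \prod_(p <- m.2) root_density p = \prod_(p <- m.2) (2 / p%:R)).
  by apply: root_ind_count => // p /mP /hP.
apply: eq_big_seq => p /mP /hP [pp _ _].
by rewrite /root_density pp.
Qed.
(** * Reciprocal sums over primes in dyadic ranges *)

Lemma bin_le_exp2 (n k : nat) : ('C(n, k) <= 2 ^ n)%N.
Proof.
elim: n k => [|n IH] [|k] //; first by rewrite bin0 expn_gt0.
by rewrite binS expnS mul2n -addnn leq_add.
Qed.

(** Distinct primes are pairwise coprime, so their product divides whatever
    each of them divides. *)
Lemma prod_primes_dvdn (s : seq nat) (m : nat) :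
  uniq s -> (forall p, p \in s -> prime p /\ (p %| m)%N) ->
  (\prod_(p <- s) p %| m)%N.
Proof.
elim: s => [|p s IH] /=; first by rewrite big_nil.
move=> /andP[ps us] hs; rewrite big_cons.
have [pp pm] := hs p (mem_head _ _).
rewrite Gauss_dvd ?pm ?IH //; first by move=> q qs; apply: hs; rewrite inE qs orbT.
rewrite big_seq; apply: (big_ind (coprime p)) => [|x y|q qs]; first exact: coprimen1.
  by rewrite coprimeMr => -> ->.
have [qp _] := hs q (mem_behead (s := p :: s) qs).
by rewrite prime_coprime // dvdn_prime2 //; apply: contraNneq ps => ->.
Qed.

Lemma prime_dvd_fact_leq (p n : nat) : prime p -> (p %| n`!)%N -> (p <= n)%N.
Proof.
move=> pp; elim: n => [|n IH]; first by rewrite dvdn1 => /eqP p1; rewrite p1 in pp.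
rewrite factS Euclid_dvdM // => /orP[/dvdn_leq->//|/IH/leq_trans->//].
Qed.

(** Chebyshev's bound: the primes between n and 2n all divide the binomial
    coefficient of 2n over n, which is at most 4 ^ n; take n = 2 ^ j. *)
Lemma primes_dyadic_count (j : nat) :
  (j * size [seq p <- index_iota (2 ^ j).+1 (2 ^ j.+1).+1 | prime p] <= 2 * 2 ^ j)%N.
Proof.
set s := [seq p <- _ | _].
have hs p : p \in s -> [/\ prime p, (2 ^ j < p)%N & (p <= 2 ^ j.+1)%N].
  by rewrite mem_filter mem_index_iota ltnS => /and3P[].
have us : uniq s by rewrite filter_uniq // iota_uniq.
set n := (2 ^ j)%N.
have dv : (\prod_(p <- s) p %| 'C(2 * n, n))%N.
  apply: prod_primes_dvdn => // p /hs[pp np pn]; split=> //.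
  have : (p %| (2 * n)`!)%N.
    by rewrite dvdn_fact // prime_gt0 //= /n -expnS.
  have -> : ((2 * n)`! = 'C(2 * n, n) * (n`! * n`!))%N.
    by rewrite -(@bin_fact (2 * n) n) ?mul2n -?addnn ?leq_addr // addnK.
  rewrite !Euclid_dvdM // orbb => /orP[//|/(prime_dvd_fact_leq pp)].
  by rewrite leqNgt np.
have le1 : (2 ^ (j * size s) <= \prod_(p <- s) p)%N.
  have hs' p : p \in s -> (2 ^ j <= p)%N by move=> /hs[_ /ltnW].
  elim: (s) hs' => [|p s' IH] hp; first by rewrite muln0 big_nil.
  rewrite big_cons mulnS expnD leq_mul ?hp ?mem_head // IH // => q qs.
  by apply: hp; rewrite inE qs orbT.
rewrite -(leq_exp2l (m := 2)) //.
apply: leq_trans le1 _; apply: leq_trans (dvdn_leq _ dv) (bin_le_exp2 _ _).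
by rewrite bin_gt0 mul2n -addnn leq_addr.
Qed.

Lemma prod_ge_1_sub_sum (R : realDomainType) (I : Type) (s : seq I) (P : pred I) (x : I -> R) :
  (forall i, P i -> 0 <= x i <= 1) ->
  1 - \sum_(i <- s | P i) x i <= \prod_(i <- s | P i) (1 - x i).
Proof.
move=> x01; elim: s => [|i s IH]; first by rewrite !big_nil subr0.
rewrite !big_cons; case: ifP => // Pi; have := x01 i Pi.
have : \prod_(j <- s | P j) (1 - x j) <= 1.
  by apply: prodr_ile1 => j /x01; lra.
move: IH; set S := \sum_(_ <- _ | _) _; set V := \prod_(_ <- _ | _) _ => *; nra.
Qed.

Lemma root_density_01 p : 0 <= root_density p <= 1.
Proof.
rewrite /root_density; case: ifP => [pp|_]; last by rewrite lexx ler01.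
rewrite divr_ge0 //= ler_pdivrMr ?ltr0n ?prime_gt0 // mul1r.
by rewrite (ler_nat _ 2) prime_gt1.
Qed.

Lemma density_dyadic_sum (j : nat) : (0 < j)%N ->
  \sum_((2 ^ j).+1 <= p < (2 ^ j.+1).+1 | prime p) root_density p <= 4 / j%:R.
Proof.
move=> j0; have jp : 0 < j%:R :> rat by rewrite ltr0n.
have p2 : 0 < 2 ^+ j :> rat by rewrite exprn_gt0.
apply: le_trans (_ : \sum_((2 ^ j).+1 <= p < (2 ^ j.+1).+1 | prime p) 2 / 2 ^+ j <= _).
  rewrite big_nat_cond [leRHS]big_nat_cond; apply: ler_sum => p /andP[/andP[pj _] pp].
  rewrite /root_density pp ler_wpM2l // lef_pV2 ?posrE ?ltr0n ?prime_gt0 //.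
  by rewrite -natrX ler_nat ltnW.
rewrite -big_filter big_const_seq count_predT iter_addr_0.
rewrite ler_pdivlMr //.
have := primes_dyadic_count j; set n := size _ => hn.
have : j%:R * n%:R <= 2 * 2 ^+ j :> rat by rewrite -natrX -!natrM ler_nat.
move=> hc; rewrite -[_ *+ n]mulr_natl; set c : rat := n%:R in hc *.
have -> : c * (2 / 2 ^+ j) * j%:R = 2 * (j%:R * c) / 2 ^+ j by field; lra.
by rewrite ler_pdivrMr //; lra.
Qed.

Lemma density_sum (J m : nat) : (0 < J)%N -> (J <= m)%N ->
  \sum_((2 ^ J).+1 <= p < (2 ^ m).+1 | prime p) root_density p
    <= (m - J)%:R * (4 / J%:R).
Proof.
move=> J0 /subnKC <-; set n := (m - J)%N; rewrite addKn.
have Jp : 0 < J%:R :> rat by rewrite ltr0n.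
elim: n => [|n IH]; first by rewrite addn0 big_geq // mul0r.
rewrite (@big_cat_nat _ _ _ (2 ^ (J + n)).+1) /=; last 2 first.
- by rewrite ltnS leq_pexp2l // leq_addr.
- by rewrite ltnS leq_pexp2l // leq_add2l.
rewrite -natr1 mulrDl mul1r lerD // addnS.
apply: le_trans (density_dyadic_sum _) _; first by rewrite addn_gt0 J0.
rewrite ler_wpM2l // lef_pV2 ?posrE //; last by rewrite ltr0n addn_gt0 J0.
by rewrite ler_nat leq_addr.
Qed.

(** Chosen so that falling4 j / falling4 j.+1 = 1 - 4 / j. *)
Definition falling4 (j : nat) : rat :=
  (j%:R - 1) * (j%:R - 2) * (j%:R - 3) * (j%:R - 4).

(** Over the primes between 2 ^ j and 2 ^ j.+1 the densities sum to at most
    4 / j, so the product of the complements is at least 1 - 4 / j; these lower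
    bounds telescope. *)
Lemma density_prod (J m : nat) : (5 <= J)%N -> (J <= m)%N ->
  falling4 J / falling4 m <= \prod_((2 ^ J).+1 <= p < (2 ^ m).+1 | prime p) (1 - root_density p).
Proof.
move=> J5 /subnKC <-; set n := (m - J)%N; pose f := falling4; rewrite -/(f _) -/(f (J + n)%N).
have fE j : f j = (j%:R - 1) * (j%:R - 2) * (j%:R - 3) * (j%:R - 4) by [].
have f0 j : (5 <= j)%N -> 0 < f j.
  by rewrite -(ler_nat rat) => h; rewrite fE !mulr_gt0 //; lra.
elim: n => [|n IH]; first by rewrite addn0 big_geq // divff // lt0r_neq0 // f0.
rewrite (@big_cat_nat _ _ _ (2 ^ (J + n)).+1) /=; last 2 first.
- by rewrite ltnS leq_pexp2l // leq_addr.
- by rewrite ltnS leq_pexp2l // leq_add2l.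
rewrite addnS; have := leq_trans J5 (leq_addr n J); move: (J + n)%N IH => j IH j5.
have j5' : 5 <= j%:R :> rat by rewrite (ler_nat _ 5).
have fj : f j.+1 = j%:R * (j%:R - 1) * (j%:R - 2) * (j%:R - 3) by rewrite fE -natr1; ring.
have -> : f J / f j.+1 = f J / f j * (1 - 4 / j%:R).
  by rewrite fj (fE j); field; repeat (apply/andP; split); lra.
apply: ler_pM => //.
- by rewrite divr_ge0 // ltW // f0.
- by rewrite subr_ge0 ler_pdivrMr; lra.
apply: le_trans (prod_ge_1_sub_sum _ _); last by move=> p _; apply: root_density_01.
rewrite lerD2l lerN2 density_dyadic_sum //; lia.
Qed.
(** * Doubly exponential blocks of primes *)

(** Sieving primes are grouped by squaring: with J a power of 2, consecutive
    blocks tile the primes above 256, each has bounded reciprocal sum, and the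
    block sizes 2 ^ (2 J) decrease so fast that the truncated expansions of all
    blocks multiply to a fixed power of the largest one. *)
Definition prime_block (M J : nat) : seq nat :=
  [seq p <- index_iota (2 ^ J).+1 (2 ^ (2 * J)).+1 | prime p && ~~ (p %| M)%N].

Lemma mem_prime_block (M J p : nat) :
  (p \in prime_block M J) =
  [&& prime p, ~~ (p %| M)%N, (2 ^ J < p)%N & (p <= 2 ^ (2 * J))%N].
Proof. by rewrite mem_filter mem_index_iota ltnS -andbA. Qed.

Lemma prime_block_size (M J : nat) : (size (prime_block M J) <= 2 ^ (2 * J))%N.
Proof.
by rewrite size_filter (leq_trans (count_size _ _)) // size_iota subSS leq_subr.
Qed.

Lemma prime_block_sum (M J : nat) : (0 < J)%N ->
  \sum_(p <- prime_block M J) root_density p <= 4.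
Proof.
move=> J0; rewrite big_filter big_mkcondr.
apply: le_trans (_ : \sum_((2 ^ J).+1 <= p < (2 ^ (2 * J)).+1 | prime p) root_density p <= _).
  apply: ler_sum => p _; case: ifP => // _.
  by have /andP[] := root_density_01 p.
apply: le_trans (density_sum J0 (leq_pmull J _)) _ => //.
rewrite mul2n -addnn addnK mulrCA divff ?mulr1 // pnatr_eq0; lia.
Qed.

(** For J >= 8 and y <= 4 one has 2 J - y <= 3 (J - y), so the four factors of
    falling4 lose at most 3 ^ 4 = 81 from J to 2 J.  This is why the sieve
    starts above 2 ^ 8 = 256. *)
Lemma prime_block_prod (M J : nat) : (8 <= J)%N ->
  1 / 81 <= \prod_(p <- prime_block M J) (1 - root_density p).
Proof.
move=> J8; rewrite big_filter big_mkcondr.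
apply: le_trans (_ : \prod_((2 ^ J).+1 <= p < (2 ^ (2 * J)).+1 | prime p) (1 - root_density p) <= _); last first.
  apply: ler_prod => p _; have := root_density_01 p.
  by case: ifP => _ h; apply/andP; split; lra.
apply: (le_trans _ (density_prod (leq_trans _ J8) (leq_pmull J (ltn0Sn 1)))); last by [].
have x8 : 8 <= J%:R :> rat by rewrite (ler_nat _ 8).
have bnd (y : rat) : 0 < y -> y <= 4 -> 0 < 2 * J%:R - y /\ 2 * J%:R - y <= 3 * (J%:R - y).
  by move=> *; split; lra.
have [p1 b1] : 0 < 2 * J%:R - 1 :> rat /\ 2 * J%:R - 1 <= 3 * (J%:R - 1) :> rat by apply: bnd; lra.
have [p2 b2] := bnd 2 isT isT.
have [p3 b3] := bnd 3 isT isT.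
have [p4 b4] := bnd 4 isT isT.
rewrite /falling4 natrM ler_pdivlMr; last by rewrite !mulr_gt0.
rewrite mul1r mulrC ler_pdivrMr; last lra.
have -> : (J%:R - 1) * (J%:R - 2) * (J%:R - 3) * (J%:R - 4) * 81 =
  (3 * (J%:R - 1)) * (3 * (J%:R - 2)) * (3 * (J%:R - 3)) * (3 * (J%:R - 4)) :> rat by ring.
have q1 := ltW p1; have q2 := ltW p2; have q3 := ltW p3; have q4 := ltW p4.
apply: (ler_pM _ q4 _ b4); first by rewrite !mulr_ge0.
apply: (ler_pM _ q3 _ b3); first by rewrite mulr_ge0.
exact: ler_pM.
Qed.

(** Passing from n to n + 1 multiplies 4 ^ (2 n + 5) 2 ^ n by 32 and the
    factorial of 2 n + 5 by at least 42.  Starting from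
    81 * 4 ^ 5 = 82944 <= 83040 = 692 * 5!, the surplus 2 ^ 12 = 4096 gained
    after twelve steps exceeds 4 * 692. *)
Lemma factorial_bound (m : nat) :
  81 * 4 ^+ (2 * (14 + m)).+1 * 2 ^+ m.+2 <= ((2 * (14 + m)).+1)`!%:R :> rat.
Proof.
have h n : 81 * 4 ^+ (2 * (2 + n)).+1 * 2 ^+ n <= 692 * ((2 * (2 + n)).+1)`!%:R :> rat.
  elim: n => [|n IH].
    have -> : ((2 * (2 + 0)).+1 = 5)%N by [].
    have -> : 5`!%:R = 120 :> rat by [].
    by rewrite !exprS !expr0; lra.
  have -> : ((2 * (2 + n.+1)).+1 = (2 * (2 + n)).+3)%N by lia.
  move: IH; set N := (2 * (2 + n)).+1 => IH.
  rewrite (factS N.+1) (factS N) 2!natrM 2!(exprS 4) (exprS 2 n).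
  have h1 : 42 <= N.+2%:R * N.+1%:R :> rat by rewrite -natrM (ler_nat _ 42) /N; nia.
  have h2 : 0 <= N`!%:R :> rat by rewrite ler0n.
  have h3 : 42 * N`!%:R <= N.+2%:R * (N.+1%:R * N`!%:R) :> rat.
    by rewrite mulrA ler_wpM2r.
  move: (4 ^+ N) (2 ^+ n) (N`!%:R) (N.+2%:R) (N.+1%:R) h2 h3 IH => A B C D E h2 h3 IH.
  lra.
have := h (12 + m)%N; have -> : (2 + (12 + m) = 14 + m)%N by lia.
move: (_`!%:R) (ler0n rat (2 * (14 + m)).+1`!) => F F0.
have A0 : 0 <= 4 ^+ (2 * (14 + m)).+1 :> rat by rewrite exprn_ge0.
have B0 : 0 <= 2 ^+ m :> rat by rewrite exprn_ge0.
have E12 : 2 ^+ 12 = 4096 :> rat by rewrite !exprS expr0; lra.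
rewrite exprD E12 (exprS 2 m.+1) (exprS 2 m).
move: (4 ^+ _) (2 ^+ m) A0 B0 => A B A0 B0 h1.
have AB := mulr_ge0 A0 B0.
lra.
Qed.

(** Half the truncation order in block l of i.  It is smallest for the top
    block, whose primes are the most expensive, and grows by one per block
    further down: enough to make the truncation errors summable, and harmless
    since the logarithm of the size of the primes is halved in each step. *)
Definition trunc_order (i l : nat) : nat := (14 + (i - l.+1))%N.

(** Here e is the first omitted symmetric function, A bounds the power S of the
    sum of weights, F is the factorial dividing it, V is the product over the
    block and 1 / B is the admissible relative loss. *)
Lemma truncation_tail_le (R : realFieldType) (A B F S V e : R) :
  0 < B -> 0 < A -> 0 <= e -> 81 * A * B <= F -> e * F <= S -> S <= A ->
  1 / 81 <= V -> e <= 1 / B * V.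
Proof.
move=> B0 A0 e0 hF hS hA hV.
have h1 : e * (81 * A * B) <= e * F by exact: ler_wpM2l.
have h2 : (81 * (e * B)) * A <= 1 * A.
  have -> : (81 * (e * B)) * A = e * (81 * A * B) by ring.
  lra.
rewrite (ler_pM2r A0) in h2.
rewrite mul1r mulrC ler_pdivlMr //; lra.
Qed.

Lemma prime_block_esym (i l M : nat) : (l < i)%N ->
  esym root_density (prime_block M (2 ^ (l + 3))) (2 * trunc_order i l).+1 <=
  2 ^+ l / 2 ^+ i.+1 *
    \prod_(p <- prime_block M (2 ^ (l + 3))) (1 - root_density p).
Proof.
move=> li; set J := (2 ^ (l + 3))%N; set s := prime_block M J.
have J8 : (8 <= J)%N by rewrite (leq_exp2l (m := 2) 3) // leq_addl.
have V := prime_block_prod M J8; rewrite -/s in V.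
have d0 p : 0 <= root_density p by have /andP[] := root_density_01 p.
have S4 : \sum_(p <- s) root_density p <= 4 by apply: prime_block_sum; lia.
have := esym_le_fact s (2 * trunc_order i l).+1 d0.
have := factorial_bound (i - l.+1); rewrite -/(trunc_order i l).
set F := _`!%:R; set e := esym _ _ _; set N := (2 * _).+1.
have S0 : 0 <= \sum_(p <- s) root_density p by apply: sumr_ge0 => p _.
have : (\sum_(p <- s) root_density p) ^+ N <= 4 ^+ N by rewrite lerXn2r ?nnegrE.
set SN := (\sum_(p <- s) _) ^+ N => h1 h2 h3.
have A0 : 0 < 4 ^+ N :> rat by rewrite exprn_gt0.
have B0 : 0 < 2 ^+ (i - l.+1).+2 :> rat by rewrite exprn_gt0.
have e0 : 0 <= e by apply: esym_ge0.
have -> : 2 ^+ l / 2 ^+ i.+1 = 1 / 2 ^+ (i - l.+1).+2 :> rat.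
  have -> : 2 ^+ i.+1 = 2 ^+ (i - l.+1).+2 * 2 ^+ l :> rat.
    by rewrite -exprD; congr (_ ^+ _); lia.
  have : 0 < 2 ^+ l :> rat by rewrite exprn_gt0.
  by move=> l0; field; rewrite !lt0r_neq0.
exact: truncation_tail_le B0 A0 e0 h2 h3 h1 V.
Qed.
Lemma prime_block_disjoint (M l l' p : nat) :
  p \in prime_block M (2 ^ (l + 3)) -> p \in prime_block M (2 ^ (l' + 3)) -> l = l'.
Proof.
rewrite !mem_prime_block => /and4P[_ _ h1 h2] /and4P[_ _ h1' h2'].
have aux m n : (m < n)%N -> (2 ^ (2 * 2 ^ (m + 3)) <= 2 ^ (2 ^ (n + 3)))%N.
  by move=> mn; rewrite leq_exp2l // -expnS leq_exp2l // -addSn leq_add2r.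
case: (ltngtP l l') => // /aux h.
- by have := leq_trans h1' (leq_trans h2 h); rewrite ltnn.
- by have := leq_trans h1 (leq_trans h2' h); rewrite ltnn.
Qed.

Lemma prime_block_cover (M i p : nat) :
  prime p -> ~~ (p %| M)%N -> (256 < p)%N -> (p <= 2 ^ (2 ^ (i + 3)))%N ->
  exists2 l, (l < i)%N & p \in prime_block M (2 ^ (l + 3)).
Proof.
move=> pp pM p256; elim: i => [|i IH] pi.
  by move: (leq_trans p256 pi); rewrite (_ : 2 ^ (2 ^ (0 + 3)) = 256)%N.
case: (leqP p (2 ^ (2 ^ (i + 3)))) => [/IH[l li pl]|ip].
  by exists l => //; apply: ltnW.
by exists i => //; rewrite mem_prime_block pp pM ip -expnS -addSn.
Qed.

(** The square of the largest integer of block l, an upper bound for four times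
    the number of primes in the block. *)
Definition block_weight (l : nat) : rat := 2 ^+ (2 ^ (l + 5)).

Lemma prime_block_weight (M l : nat) :
  4 * (size (prime_block M (2 ^ (l + 3))))%:R <= block_weight l.
Proof.
apply: le_trans (_ : 4 * (2 ^ (2 * 2 ^ (l + 3)))%N%:R <= _).
  by rewrite ler_wpM2l // ler_nat prime_block_size.
rewrite natrX (_ : 4 = 2 ^+ 2) -?exprD; last by rewrite expr2; ring.
rewrite ler_eXn2l // -expnS -addnS (addnS l 4) expnS mul2n -addnn leq_add2r.
by rewrite (leq_exp2l (m := 2) 1) // addnS.
Qed.

(** With E j the exponent on the right, a further block contributes at most
    2 ^ (j + 5) (31 + 2 (i - j.+1)), which is what E j.+1 - E j leaves room for.
    For j = i and Z = 2 ^ (2 ^ (i + 3)) the bound reads Z ^ 132. *)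
Lemma block_norm_bound (i j : nat) : (j <= i)%N ->
  \prod_(l < j) (2 * block_weight l ^+ (2 * trunc_order i l).+2)
    <= 2 ^+ (2 ^ (j + 5) * (33 + 2 * (i - j))).
Proof.
elim: j => [|j IH] ji; first by rewrite big_ord0 exprn_ege1.
rewrite big_ord_recr /=.
rewrite -[X in X * block_weight _ ^+ _]expr1 /block_weight -exprM -exprD.
have {}IH := IH (ltnW ji).
apply: le_trans (ler_wpM2r _ IH) _; first by rewrite exprn_ge0.
rewrite -exprD ler_eXn2l // addSn expnS.
have : (1 <= 2 ^ (j + 5))%N by rewrite expn_gt0.
have : (i - j = (i - j.+1).+1)%N by lia.
rewrite /trunc_order; move: (2 ^ (j + 5))%N (i - j.+1)%N (i - j)%N => E m n -> E1.
nia.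
Qed.

Lemma half_geometric_sum (i : nat) : \sum_(l < i) (2 ^+ l / 2 ^+ i.+1 : rat) <= 1 / 2.
Proof.
have h n : \sum_(l < n) 2 ^+ l = 2 ^+ n - 1 :> rat.
  by elim: n => [|n IH]; rewrite ?big_ord0 ?expr0 ?subrr // big_ord_recr /= IH exprS; ring.
rewrite -mulr_suml h exprS.
have : 0 < 2 ^+ i :> rat by rewrite exprn_gt0.
by set x := 2 ^+ i => x0; rewrite ler_pdivrMr; lra.
Qed.

(** With Z = 2 ^ (2 ^ (i + 3)), the sum of the lower sieve function over
    Z ^ 141 terms has main term at least Z ^ 141 / (2 * 81 ^ i), while the error
    is at most Z ^ 132.  As 2 * 81 ^ i < Z ^ 9, the sum is positive, so the
    function is positive somewhere, and there no prime of any block divides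
    the value. *)
Lemma rough_value_exists (b : int) (r M i : nat) :
  (forall p, prime p -> (p <= 256)%N -> (p %| M)%N) ->
  (forall p, prime p -> (p %| `|b|)%N -> (p %| M)%N) ->
  exists2 t, (t < 2 ^ (141 * 2 ^ (i + 3)))%N &
    let n : nat := (r + M * t)%N in
    forall p, prime p -> ~~ (p %| M)%N -> (p%:Z %| n%:Z * (b * n%:Z + 1))%Z ->
    (2 ^ (2 ^ (i + 3)) < p)%N.
Proof.
move=> M256 Mb; set T := (2 ^ _)%N.
pose ps l := prime_block M (2 ^ (l + 3)).
pose k := trunc_order i.
have ups l : uniq (ps l) by rewrite filter_uniq // iota_uniq.
have W2 l : 2 <= block_weight l.
  by rewrite -[leLHS]expr1 ler_eXn2l // expn_gt0.
have [_ ml] := multilinear_blocks k i ups (@prime_block_disjoint M)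
  (prime_block_weight M) W2.
have hP p : (exists2 l, (l < i)%N & p \in ps l) ->
    [/\ prime p, ~~ (p %| M)%N & ~~ (p %| `|b|)%N].
  move=> [l _]; rewrite mem_prime_block => /and4P[pp pM _ _]; split => //.
  by apply: contra pM; apply: Mb.
have := multilinear_count r T ml hP.
move/le_trans => /(_ _ (block_norm_bound (leqnn i))).
rewrite subnn muln0 addn0.
set N := 2 ^+ _; set S := \sum_(t < T) _; set D := blocks_lower _ _ _ _ => hSD.
have hD : 1 / 2 * (1 / 81) ^+ i <= D.
  have dens := root_density_01.
  have e0 l : 0 <= (2 ^+ l / 2 ^+ i.+1 : rat) by rewrite divr_ge0 // exprn_ge0.
  have := blocks_lower_main dens (fun l (li : (l < i)%N) => prime_block_esym M li) e0.
  apply: le_trans.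
  have [/andP[_ h] _] := blocks_sound ps k i dens.
  have h81 : (1 / 81) ^+ i <= \prod_(l < i) \prod_(p <- ps l) (1 - root_density p).
    rewrite -[in leLHS](card_ord i) -prodr_const; apply: ler_prod => l _.
    apply/andP; split; first by lra.
    by apply: prime_block_prod; rewrite (leq_exp2l (m := 2) 3) // leq_addl.
  have := half_geometric_sum i; set s := \sum_(l < i) _ => hs.
  have p0 : 0 <= (1 / 81 : rat) ^+ i by apply: exprn_ge0; lra.
  by apply: (ler_pM _ p0 _ (le_trans h81 h)); lra.
have ND : N < T%:R * D.
  apply: lt_le_trans (_ : T%:R * (1 / 2 * (1 / 81) ^+ i) <= _); last by rewrite ler_wpM2l.
  have -> : T%:R = N * 2 ^+ (9 * 2 ^ (i + 3)) :> rat.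
    by rewrite /N -exprD natrX; congr (_ ^+ _); rewrite (addnS i 4) (addnS i 3) !expnS; ring.
  have N0 : 0 < N by rewrite exprn_gt0.
  suff key : 1 < 2 ^+ (9 * 2 ^ (i + 3)) * (1 / 2 * (1 / 81) ^+ i) :> rat.
    by rewrite -[X in _ < X]mulrA ltr_pMr.
  have : (81 : rat) ^+ i <= 2 ^+ (7 * i).
    have b7 : 81 <= 2 ^+ 7 :> rat by rewrite !exprS expr0; lra.
    by rewrite exprM; apply: (lerXn2r _ _ _ b7); rewrite nnegrE; lra.
  have : 2 ^+ (7 * i) * 2 ^+ 2 <= 2 ^+ (9 * 2 ^ (i + 3)) :> rat.
    rewrite -exprD ler_eXn2l // expnD; have := ltn_expl i (ltnSn 1).
    by move: (2 ^ i)%N => e; lia.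
  have : 0 < (81 : rat) ^+ i by apply: exprn_gt0; lra.
  rewrite [(1 / 81) ^+ i]expr_div_n expr1n.
  set x := 81 ^+ i; set y := 2 ^+ (7 * i); set z := 2 ^+ (9 * _) => x0 h1 h2.
  have -> : z * (1 / 2 * (1 / x)) = z / (2 * x) by field; lra.
  by rewrite ltr_pdivlMr ?mul1r; rewrite ?expr2 in h1; lra.
have S0 : 0 < S.
  move: hSD; rewrite ler_norml => /andP[h _]; lra.
have [t Lt] : exists t : 'I_T, 0 < blocks_lower ps k i (root_ind b (r + M * t)).
  apply/existsP; apply: contraLR S0; rewrite negb_exists => /forallP hneg.
  by rewrite -leNgt; apply: sumr_le0 => t _; rewrite leNgt.
exists t => // n p pp pM pn; rewrite ltnNge; apply/negP => pz.
have p256 : (256 < p)%N by rewrite ltnNge; apply: contra pM; apply: M256.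
have [l li pl] := prime_block_cover pp pM p256 pz.
have x01 q : 0 <= root_ind b n q <= 1.
  by rewrite /root_ind ler0n lern1 leq_b1.
have [_] := blocks_sound ps k i x01.
rewrite leNgt => /negP; apply; apply: le_lt_trans Lt.
rewrite (bigD1 (Ordinal li)) //= (big_rem p) //= {1}/root_ind pn subrr.
by rewrite !mul0r.
Qed.

(** The point is that K does not depend on the progression: once Z exceeds
    r + M and |b| + 1, one has n <= Z ^ 142 and |b n + 1| <= Z ^ 143, whatever
    M is. *)
Theorem almost_prime_values : exists K : nat, forall (b : int) (r M : nat),
  (forall p, prime p -> (p <= 256)%N -> (p %| M)%N) ->
  (forall p, prime p -> (p %| `|b|)%N -> (p %| M)%N) ->
  exists t Z : nat, let n : nat := (r + M * t)%N in
    (`|(n%:Z * (b * n%:Z + 1))%R| < Z ^ K)%N /\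
    forall p, prime p -> ~~ (p %| M)%N -> (p%:Z %| n%:Z * (b * n%:Z + 1))%Z ->
    (Z < p)%N.
Proof.
exists 286 => b r M M256 Mb; pose i := (r + M + `|b|.+2)%N.
have [t tT h] := rough_value_exists r i M256 Mb.
exists t, (2 ^ (2 ^ (i + 3)))%N; split => //.
have Zi : (i < 2 ^ (2 ^ (i + 3)))%N.
  apply: ltn_trans (ltn_expl i (ltnSn 1)) _; rewrite ltn_exp2l //.
  by apply: leq_trans (ltn_expl i (ltnSn 1)) _; rewrite leq_exp2l // leq_addr.
move: tT; rewrite mulnC expnM; move: Zi; rewrite {h}.
move: (2 ^ (2 ^ (i + 3)))%N => Z Zi tE.
have E1 : (0 < Z ^ 141)%N by apply: leq_ltn_trans tE.
have -> : (Z ^ 286 = Z * ((Z * Z ^ 141) * (Z * (Z * Z ^ 141))))%N.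
  by rewrite -!expnS -expnD -expnS.
move: (Z ^ 141)%N tE E1 => E tE E1; set n := (r + M * t)%N.
have rM : (r + M < Z)%N by rewrite /i in Zi; lia.
have b1 : (`|b| + 1 < Z)%N by rewrite /i in Zi; lia.
clearbody i => {Zi}.
have nZ : (n <= Z * E)%N by rewrite /n; nia.
have bZ : (`|(b * n%:Z + 1)%R| <= Z * (Z * E))%N.
  have h1 : (`|(b * n%:Z + 1)%R| <= `|b| * n + 1)%N.
    by have := abszM b n%:Z; rewrite absz_nat => <-; lia.
  apply: leq_trans h1 _; move: (`|b|)%N b1 => B b1; clearbody n; nia.
rewrite abszM absz_nat; apply: leq_ltn_trans (leq_mul nZ bZ) _.
have Z1 : (1 < Z)%N by lia.
by rewrite -[ltnLHS]mul1n ltn_mul2r Z1 !muln_gt0 E1 (ltnW Z1).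
Qed.
(** * Divisors and linear congruences *)

(** Such an h has fewer than K prime factors, counted with multiplicity;
    removing one of them at most halves the number of divisors. *)
Lemma rough_divisors_size (Z K h : nat) : (0 < h)%N -> (h < Z ^ K)%N ->
  (forall p, prime p -> (p %| h)%N -> (Z < p)%N) ->
  (size (divisors h) <= 2 ^ K)%N.
Proof.
elim: K h => [|K IH] h h0 hZ rough; first by move: h0 hZ; case: h {rough}.
case: (ltngtP h 1) => [|h1|->]; first by case: h h0 {hZ rough}.
  2: by rewrite -[size _]/1%N expn_gt0.
have pp := pdiv_prime h1; set p := pdiv h in pp.
have ph : (p %| h)%N := pdiv_dvd h.
have Zp := rough p pp ph.
set g := (h %/ p)%N; have hE : h = (g * p)%N by rewrite /g divnK.
have g0 : (0 < g)%N by move: h0; rewrite hE muln_gt0 => /andP[].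
have gZ : (g < Z ^ K)%N.
  rewrite -(ltn_pmul2r (prime_gt0 pp)) -hE (leq_trans hZ) // expnSr leq_mul2l.
  by rewrite (ltnW Zp) orbT.
have IHg : (size (divisors g) <= 2 ^ K)%N.
  by apply: IH => // q qp qg; apply: rough => //; rewrite hE dvdn_mulr.
pose L := divisors g ++ [seq (p * d)%N | d <- divisors g].
apply: leq_trans (_ : size L <= _)%N.
  apply: uniq_leq_size => [|d]; first exact: divisors_uniq.
  rewrite -dvdn_divisors // => dh; rewrite mem_cat -dvdn_divisors //.
  case: (boolP (p %| d)%N) => pd.
    apply/orP; right; apply/mapP; exists (d %/ p)%N; last by rewrite mulnC divnK.
    by rewrite -dvdn_divisors // dvdn_divLR // ?prime_gt0 // -hE.
  apply/orP; left; move: dh; rewrite hE Gauss_dvdl //.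
  by rewrite coprime_sym prime_coprime.
by rewrite size_cat size_map expnS mul2n -addnn leq_add.
Qed.

(** A divisor is the product of its part at the primes of pi, which divides e,
    and of its part away from pi. *)
Lemma dvdn_split_pi (pi : nat_pred) (x e d : nat) : (0 < x)%N -> (0 < e)%N ->
  (x`_pi %| e)%N -> (d %| x)%N ->
  d \in [seq (u * v)%N | u <- divisors e, v <- divisors x`_pi^'].
Proof.
move=> x0 e0 xe dx; have d0 : (0 < d)%N := dvdn_gt0 x0 dx.
apply/allpairsP; exists (d`_pi, d`_pi^')%N; rewrite /= partnC // -!dvdn_divisors //.
by split => //; rewrite ?partn_dvd // (dvdn_trans _ xe) // partn_dvd.
Qed.

Lemma linear_congruence (a c : int) (M : nat) : (0 < M)%N -> coprimez a M%:Z ->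
  exists n : nat, (M%:Z %| a * n%:Z - c)%Z.
Proof.
move=> M0 /coprimezP [[u v] /= uv].
have Mz : M%:Z != 0 by rewrite eqz_nat -lt0n.
exists `|((u * c) %% M%:Z)%Z|%N; rewrite gez0_abs ?modz_ge0 //.
have := divz_eq (u * c) M%:Z.
set q := (_ %/ _)%Z; set m := (_ %% _)%Z => E.
have -> : m = u * c - q * M%:Z by rewrite E; ring.
apply/dvdzP; exists (- a * q - v * c).
by rewrite -[X in _ - X]mul1r -uv; ring.
Qed.

Lemma linear_congruence2 (a1 c1 a2 c2 : int) (M1 M2 : nat) :
  (0 < M1)%N -> (0 < M2)%N -> coprime M1 M2 ->
  coprimez a1 M1%:Z -> coprimez a2 M2%:Z ->
  exists n : nat, (M1%:Z %| a1 * n%:Z - c1)%Z /\ (M2%:Z %| a2 * n%:Z - c2)%Z.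
Proof.
move=> M10 M20 M12 h1 h2.
have [n1 hn1] := linear_congruence c1 M10 h1.
have [n2 hn2] := linear_congruence c2 M20 h2.
exists (chinese M1 M2 n1 n2); set n := chinese _ _ _ _.
have key (a c : int) (M m : nat) : (n = m %[mod M])%N ->
    (M%:Z %| a * m%:Z - c)%Z -> (M%:Z %| a * n%:Z - c)%Z.
  move=> nm hm; have -> : a * n%:Z - c = a * (n%:Z - m%:Z) + (a * m%:Z - c) by ring.
  rewrite rpredD // dvdz_mull // -eqz_mod_dvd; apply/eqP.
  by rewrite !modz_nat nm.
by split; [apply: key hn1|apply: key hn2]; rewrite /n ?chinese_modl ?chinese_modr.
Qed.

Lemma dvdz_shift (a c : int) (M n t : nat) :
  (M%:Z %| a * n%:Z - c)%Z -> (M%:Z %| a * (n + M * t)%N%:Z - c)%Z.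
Proof.
move=> h; rewrite PoszD PoszM.
have -> : a * (n%:Z + M%:Z * t%:Z) - c = (a * n%:Z - c) + M%:Z * (a * t%:Z) by ring.
by rewrite rpredD // dvdz_mulr.
Qed.

Lemma dvdn_coprime_part (a m n : nat) : (0 < a)%N -> (0 < n)%N -> coprime a m ->
  (m %| n)%N -> (m %| n`_(\pi(a)^'))%N.
Proof.
move=> a0 n0 am mn; have m0 := dvdn_gt0 n0 mn.
by rewrite -(part_pnat_id (pi := \pi(a)^') (n := m)) ?partn_dvd // -coprime_pi'.
Qed.

Lemma coprimez_part (a : int) (n : nat) : a != 0 -> coprimez a (n`_(\pi(`|a|)^'))%N%:Z.
Proof.
move=> a0; rewrite /coprimez /gcdz absz_nat.
by rewrite eqz_nat -/(coprime _ _) coprime_pi' ?absz_gt0 // part_pnat.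
Qed.
(** * Values with many and with few divisors *)

Lemma dvdn_prod_mem (s : seq nat) (m : nat) : m \in s -> (m %| \prod_(i <- s) i)%N.
Proof. by move=> ms; rewrite (big_rem m) //= dvdn_mulr. Qed.

Lemma prod_mem_gt0 (s : seq nat) : (forall m, m \in s -> (0 < m)%N) ->
  (0 < \prod_(i <- s) i)%N.
Proof. by move=> hs; rewrite big_seq; apply: prodn_cond_gt0. Qed.

Lemma value_coprime_leading (a n : int) : coprimez a n -> coprimez a (n * (a * n + 1)).
Proof.
move=> an; rewrite coprimezMr an /=; apply/coprimezP; exists (- n, 1) => /=; ring.
Qed.

Lemma value_neq0 (c : int) (n : nat) : (1 < n)%N -> n%:Z * (c * n%:Z + 1) != 0.
Proof.
move=> n1; apply: mulf_neq0; first by rewrite eqz_nat -lt0n; apply: leq_trans n1.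
apply/eqP => hc; have : (n%:Z %| 1%R)%Z.
  by apply/dvdzP; exists (- c); apply: (addrI (c * n%:Z)); rewrite hc; ring.
by rewrite dvdzE /= dvdn1 => /eqP nE; move: n1; rewrite nE.
Qed.

(** Let n be 0 modulo the part of the product of s at the primes of b, and
    - 1 / b modulo the remaining part times a.  Then n (b n + 1) is a multiple
    of every element of s, while n and a n + 1 are both prime to a. *)
Lemma multiples_avoiding (a b : int) (s : seq nat) (n0 : nat) :
  a != 0 -> b != 0 -> coprime `|a| `|b| -> (forall m, m \in s -> (0 < m)%N) ->
  exists n : nat, [/\ (n0 <= n)%N,
    forall m, m \in s -> (m%:Z %| n%:Z * (b * n%:Z + 1))%Z
    & coprimez a (n%:Z * (a * n%:Z + 1))].
Proof.
move=> a0 b0 ab s0; set W := (\prod_(i <- s) i)%N.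
have W0 : (0 < W)%N := prod_mem_gt0 s0.
have Wa0 : (0 < W * `|a|)%N by rewrite muln_gt0 W0 absz_gt0.
have c1 : coprimez 1 (W`_\pi(`|b|))%N%:Z by rewrite /coprimez gcd1z.
have [n1 [h1 h2]] := linear_congruence2 0 (-1) (part_gt0 _ _) (part_gt0 _ _)
  (coprime_partC \pi(`|b|%N) W (W * `|a|%N)) c1 (coprimez_part _ b0).
move: (part_gt0 \pi(`|b|%N) W) (part_gt0 (\pi(`|b|%N)^') (W * `|a|%N)).
set M1 := (W`__)%N in h1 *; set M2 := ((W * _)`__)%N in h2 * => M10 M20.
pose n := (n1 + M1 * (M2 * n0))%N.
have {}h1 : (M1%:Z %| n%:Z)%Z.
  by have := dvdz_shift (M2 * n0) h1; rewrite mul1r subr0.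
have {}h2 : (M2%:Z %| b * n%:Z + 1)%Z.
  by have := dvdz_shift (M1 * n0) h2; rewrite mulnCA opprK.
exists n; split.
- rewrite /n; apply: leq_trans (leq_addl _ _).
  by rewrite mulnA leq_pmull // muln_gt0 M10.
- move=> m ms; have m0 := s0 m ms; have mW := dvdn_prod_mem ms.
  rewrite -(partnC \pi(`|b|%N) m0) PoszM dvdz_mul //.
    by apply: dvdz_trans h1; rewrite dvdzE /= partn_dvd.
  by apply: dvdz_trans h2; rewrite dvdzE /= partn_dvd // dvdn_mulr.
apply: value_coprime_leading.
have : (a %| b * n%:Z + 1)%Z.
  apply: dvdz_trans h2; rewrite dvdzE absz_nat dvdn_coprime_part ?absz_gt0 //.
    by rewrite coprime_sym.
  by rewrite dvdn_mull.
move=> /dvdzP [q hq]; apply/coprimezP; exists (q, - b) => /=.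
by rewrite -hq; ring.
Qed.

Lemma common_multiple_primes (N : nat) :
  exists2 P, (0 < P)%N & forall p, prime p -> (p <= N)%N -> (p %| P)%N.
Proof.
exists N`!; first exact: fact_gt0.
by move=> p pp pN; rewrite dvdn_fact // prime_gt0.
Qed.

Lemma dvdz_pi_part (x y : int) (pi : nat_pred) : x != 0 ->
  (forall p w, prime p -> p \in pi -> (0 < w)%N ->
    ((p ^ w)%N%:Z %| x)%Z -> ((p ^ w)%N%:Z %| y)%Z) ->
  ((absz x)`_pi %| `|y|)%N.
Proof.
move=> x0 h; apply/dvdn_partP => // p.
rewrite pi_of_part ?absz_gt0 // !inE => /andP[px ppi].
have pp : prime p by move: px; rewrite mem_primes => /and3P[].
rewrite partn_part; last by move=> q; rewrite inE => /eqP ->.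
have := h p (logn p `|x|) pp ppi.
rewrite !dvdzE !absz_nat p_part; apply; last exact: pfactor_dvdnn.
by rewrite logn_gt0.
Qed.

(** Impose a n = -1 modulo a large multiple M1 of the elements of s, prime to a,
    and b n = 1 modulo a ^ 2.  Since a (b n + 1) - b (a n + 1) = a - b, the value
    b n + 1 has the same valuation as a - b at the primes of M1, and at the primes
    of a it is 2 modulo p ^ 2; n itself is prime to both moduli.  So the part of
    n (b n + 1) at the primes of the modulus divides 2 (a - b).  The sieve
    chooses n in this progression so that the complementary part has at most
    2 ^ K divisors. *)
Lemma values_few_divisors (a b : int) :
  a != 0 -> b != 0 -> coprime `|a| `|b| -> a != b ->
  exists D : nat, forall (s : seq nat) (n0 : nat),
  (forall m, m \in s -> (0 < m)%N /\ coprime `|a| m) ->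
  exists n : nat, [/\ (n0 <= n)%N,
    forall m, m \in s -> (m%:Z %| a * n%:Z + 1)%Z
    & exists2 L : seq nat, (size L <= D)%N &
      forall d : nat, (d%:Z %| n%:Z * (b * n%:Z + 1))%Z -> d \in L].
Proof.
move=> a0 b0 ab abN; have [K hK] := almost_prime_values.
exists (size (divisors `|(2 * (a - b))%R|%N) * 2 ^ K)%N => s n0 hs.
have [P P0 hP] := common_multiple_primes 256.
have s0 m (ms : m \in s) : (0 < m)%N by have [] := hs m ms.
have e0 : (0 < `|(a - b)%R|)%N by rewrite absz_gt0 subr_eq0.
(* P and b supply the primes that the sieve wants in the modulus; a - b is
   needed to have its valuations strictly below those of M1 = W' ^ 2. *)
pose W := (P * `|b| * `|(a - b)%R| * \prod_(i <- s) i)%N.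
have W0 : (0 < W)%N by rewrite /W !muln_gt0 P0 absz_gt0 b0 e0 prod_mem_gt0.
pose W' := (W`_(\pi(`|a|)^'))%N.
have W'0 : (0 < W')%N by apply: part_gt0.
have cW' m : (m %| W)%N -> coprime `|a| m -> (m %| W')%N.
  by move=> mW am; apply: dvdn_coprime_part; rewrite // absz_gt0.
have aW' : coprime `|a| W' by rewrite coprime_pi' ?absz_gt0 ?part_pnat.
pose M1 := (W' ^ 2)%N; pose M2 := (`|a| ^ 2)%N.
have M10 : (0 < M1)%N by rewrite expn_gt0 W'0.
have M20 : (0 < M2)%N by rewrite expn_gt0 absz_gt0 a0.
have [n1 [h1 h2]] : exists n : nat,
    (M1%:Z %| a * n%:Z - (-1))%Z /\ (M2%:Z %| b * n%:Z - 1)%Z.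
  apply: linear_congruence2 => //.
  - by rewrite coprime_sym coprimeXl // coprimeXr.
  - by rewrite /coprimez /gcdz absz_nat eqz_nat -/(coprime _ _) coprimeXr.
  - by rewrite /coprimez /gcdz absz_nat eqz_nat -/(coprime _ _) coprimeXr // coprime_sym.
pose M := (M1 * M2)%N; have M0 : (0 < M)%N by rewrite muln_gt0 M10.
have pM p : prime p -> (p %| W)%N -> (p %| M)%N.
  move=> pp pW; case: (boolP (p %| `|a|)%N) => pa.
    by rewrite dvdn_mull // dvdn_exp.
  rewrite dvdn_mulr // dvdn_exp // cW' // coprime_sym prime_coprime //.
have [] := hK b (n1 + M * n0.+2)%N M.
- by move=> p pp p256; apply: pM => //; rewrite /W -!mulnA dvdn_mulr // hP.
- by move=> p pp pb; apply: pM => //; rewrite /W -!mulnA dvdn_mull // dvdn_mulr.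
move=> t [Z []]; rewrite -addnA -mulnDr; set n := (n1 + _)%N => xZ xrough.
have nn0 : (n0.+2 <= n)%N.
  by rewrite /n; apply: leq_trans (leq_addl _ _); rewrite (leq_trans _ (leq_pmull _ M0)) // leq_addr.
have {}h1 : (M1%:Z %| a * n%:Z + 1)%Z.
  by have := dvdz_shift (M2 * (n0.+2 + t)) h1; rewrite opprK mulnA.
have {}h2 : (M2%:Z %| b * n%:Z - 1)%Z.
  by have := dvdz_shift (M1 * (n0.+2 + t)) h2; rewrite mulnA (mulnC M2).
exists n; split.
- exact: ltnW (ltnW nn0).
- move=> m ms; have [m0 am] := hs m ms; apply: dvdz_trans h1.
  rewrite dvdzE !absz_nat; apply: dvdn_trans (dvdn_exp _ (dvdnn W')) => //.
  by apply: cW' => //; rewrite /W dvdn_mull // dvdn_prod_mem.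
set x := n%:Z * (b * n%:Z + 1) in xZ xrough *.
have x0 : x != 0 by apply: value_neq0; apply: leq_trans nn0.
have ax0 : (0 < `|x|)%N by rewrite absz_gt0.
pose e := `|(2 * (a - b))%R|%N.
have ee0 : (0 < e)%N by rewrite absz_gt0 mulf_neq0 // subr_eq0.
have xe : ((absz x)`_\pi(M) %| e)%N.
  apply: dvdz_pi_part => // p w pp; rewrite mem_primes M0 pp /= => pM' w0 pwx.
  have ppos := prime_gt0 pp.
  have pw : (p %| p ^ w)%N by rewrite dvdn_exp.
  have pn : ~~ (p %| n)%N.
    apply/negP => pn; have pz : (p%:Z %| n%:Z)%Z by rewrite dvdzE.
    suff : (p%:Z %| 1%R)%Z by rewrite dvdzE /= dvdn1 => /eqP p1; rewrite p1 in pp.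
    move: pM'; rewrite Euclid_dvdM // => /orP[pM1|pM2].
      have h : (p%:Z %| a * n%:Z + 1)%Z by apply: dvdz_trans h1.
      have -> : 1 = a * n%:Z + 1 - a * n%:Z by ring.
      by rewrite rpredB // dvdz_mull.
    have h : (p%:Z %| b * n%:Z - 1)%Z by apply: dvdz_trans h2.
    have -> : 1 = b * n%:Z - (b * n%:Z - 1) by ring.
    by rewrite rpredB // dvdz_mull.
  have pwb : ((p ^ w)%N%:Z %| b * n%:Z + 1)%Z.
    by rewrite -(@Gauss_dvdzr _ n%:Z) // coprimezE coprimeXl // prime_coprime.
  case: (boolP (p %| `|a|)%N) => pa.
    have p2 : ((p ^ 2)%N%:Z %| b * n%:Z - 1)%Z.
      by apply: dvdz_trans h2; rewrite dvdzE /= dvdn_exp2r.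
    have dvd2 (q : nat) : (q %| p ^ 2)%N -> (q %| p ^ w)%N -> (q%:Z %| 2%R)%Z.
      move=> q1 q2; have -> : 2 = b * n%:Z + 1 - (b * n%:Z - 1) by ring.
      by rewrite rpredB //; [apply: dvdz_trans pwb|apply: dvdz_trans p2].
    case: w w0 pwx pw pwb dvd2 => // -[|w] _ _ _ _ dvd2.
      by apply: dvdz_mulr; apply: dvd2; rewrite // dvdn_exp.
    have p2w : (p ^ 2 %| p ^ w.+2)%N by apply: dvdn_exp2l.
    have := dvd2 (p ^ 2)%N (dvdnn _) p2w; rewrite dvdzE => /(dvdn_leq (ltn0Sn 1)).
    have : (2 ^ 2 <= p ^ 2)%N by rewrite leq_exp2r // prime_gt1.
    by move=> /leq_trans h /h.
  apply: dvdz_mull; rewrite dvdzE absz_nat /= pfactor_dvdn //.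
  rewrite leqNgt; apply/negP; set v := logn p _ => vw.
  have pW' : (p %| W')%N.
    by move: pM'; rewrite Euclid_dvdM // !Euclid_dvdX // (negPf pa) orbF andbT.
  have pvW' : (p ^ v %| W')%N.
    apply: cW'; last by rewrite coprime_sym coprimeXl // prime_coprime.
    apply: (@dvdn_trans `|(a - b)%R|); first exact: pfactor_dvdnn.
    by rewrite /W -mulnA dvdn_mull // dvdn_mulr.
  have c1 : ((p ^ v.+1)%N%:Z %| a * n%:Z + 1)%Z.
    apply: dvdz_trans h1; rewrite dvdzE /= expnSr.
    exact: dvdn_mul.
  have c2 : ((p ^ v.+1)%N%:Z %| b * n%:Z + 1)%Z.
    by apply: dvdz_trans pwb; rewrite dvdzE /= dvdn_exp2l.
  have : ((p ^ v.+1)%N%:Z %| a - b)%Z.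
    have -> : a - b = a * (b * n%:Z + 1) - b * (a * n%:Z + 1) by ring.
    by rewrite rpredB // dvdz_mull.
  by rewrite dvdzE absz_nat pfactor_dvdn // -/v ltnn.
exists [seq (u * v)%N | u <- divisors e, v <- divisors (absz x)`_\pi(M)^'].
  rewrite size_allpairs leq_mul //; apply: (@rough_divisors_size Z) => //.
    by apply: leq_ltn_trans xZ; apply: dvdn_leq => //; apply: dvdn_part.
  move=> p pp px; apply: xrough => //.
    have := part_pnat \pi(M)^' `|x|%N.
    move=> /(pnatP _ (part_gt0 _ _)) /(_ p pp px); apply: contra => pM'.
    by rewrite mem_primes pp M0.
  by rewrite dvdzE absz_nat; apply: dvdn_trans px (dvdn_part _ _).
by move=> d dx; apply: dvdn_split_pi.
Qed.
(** * Divisor gaps and their limit superior *)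

Local Open Scope classical_set_scope.

Lemma infinite_set_uniq_seq (T : choiceType) (A : set T) (n : nat) : infinite_set A ->
  exists s : seq T, [/\ uniq s, (n <= size s)%N & forall d, d \in s -> A d].
Proof.
move=> /(infinite_set_fset n) [B BA nB]; exists (finmap.enum_fset B).
by split => //; exact: finmap.fset_uniq.
Qed.

Lemma infinite_range (T : eqType) (f : nat -> T) : injective f ->
  infinite_set [set d | exists k, d = f k].
Proof.
move=> finj fin; apply: infinite_nat.
have := @finite_preimage _ _ _ f (fun j k _ _ => @finj j k) fin.
by apply: sub_finite_set => k _; exists k.
Qed.

Lemma divisor_count_le (R : realType) (A : set nat) (m : int) (s : seq nat) :
  (forall d, A d -> (d%:Z %| m)%Z -> d \in s) ->
  (divisor_count R A m <= (size s)%:R%:E)%E.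
Proof.
move=> hs; rewrite /divisor_count /counting.
set X := [set a | _].
have Xs : X `<=` [set` s] by move=> d [Ad dm]; exact: hs.
have fX : finite_set X by apply: sub_finite_set Xs _; apply/finite_seqP; exists s.
rewrite asboolT // lee_fin ler_nat.
apply: uniq_leq_size => [|d]; first exact: finmap.fset_uniq.
by rewrite in_fset_set // => /set_mem /Xs.
Qed.

Lemma divisor_count_ge (R : realType) (A : set nat) (m : int) (s : seq nat) :
  uniq s -> (forall d, d \in s -> A d /\ (d%:Z %| m)%Z) ->
  ((size s)%:R%:E <= divisor_count R A m)%E.
Proof.
move=> us hs; rewrite /divisor_count /counting.
case: asboolP => [fX|_]; last by rewrite leey.
rewrite lee_fin ler_nat; apply: uniq_leq_size => // d /hs hd.
by rewrite in_fset_set //; apply/mem_set.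
Qed.

Lemma divisor_count_ge0 (R : realType) (A : set nat) (m : int) :
  (0 <= divisor_count R A m)%E.
Proof. by rewrite /divisor_count /counting; case: asboolP => _; rewrite ?lee_fin ?leey. Qed.

Lemma divisor_gapC (R : realType) (A : set nat) (u v : int) :
  divisor_gap R A u v = divisor_gap R A v u.
Proof.
rewrite /divisor_gap (andbC (u == 0)) (orbC (u == 0)).
case: ifP => // _; case: ifP => // _.
by move: (divisor_count R A u) (divisor_count R A v) => [x| |] [y| |] //=; rewrite distrC.
Qed.

(** A list s of divisors of u bounds one count from below, a list l containing
    all divisors of v bounds the other from above.  If v = 0 the gap is
    infinite. *)
Lemma divisor_gap_ge (R : realType) (A : set nat) (u v : int) (C : nat) (s l : seq nat) :
  u != 0 -> uniq s -> (forall d, d \in s -> A d /\ (d%:Z %| u)%Z) ->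
  (forall d, A d -> (d%:Z %| v)%Z -> d \in l) ->
  (C + size l <= size s)%N ->
  (C%:R%:E <= divisor_gap R A u v)%E.
Proof.
move=> u0 us hs hl Cs; rewrite /divisor_gap (negPf u0) /=.
case: ifP => _; first by rewrite leey.
have h1 := divisor_count_ge R us hs; have h2 := divisor_count_le R hl.
apply: le_trans (lee_abs _).
have fv : divisor_count R A v \is a fin_num.
  by rewrite ge0_fin_numE ?divisor_count_ge0 // (le_lt_trans h2) // ltry.
rewrite leeBrDr // (le_trans _ h1) //.
apply: le_trans (leeD2l _ h2) _.
by rewrite -EFinD -natrD lee_fin ler_nat.
Qed.

Lemma divisor_gap_eq0 (R : realType) (A : set nat) (u v : int) :
  A `<=` [set a : nat | (0 < a)%N] -> (u == 0) = (v == 0) ->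
  (forall d, A d -> (d%:Z %| u)%Z = (d%:Z %| v)%Z) -> divisor_gap R A u v = 0%E.
Proof.
move=> Apos uv hd; rewrite /divisor_gap -uv; case: eqP => //= /eqP u0.
have -> : divisor_count R A v = divisor_count R A u.
  congr counting; apply/seteqP; split => d /= [Ad dv]; split => //.
    by rewrite hd.
  by rewrite -hd.
rewrite subee ?abse0 //.
have h : (divisor_count R A u <= (size (divisors `|u|%N))%:R%:E)%E.
  apply: divisor_count_le => d Ad; rewrite dvdzE absz_nat => du.
  by rewrite -dvdn_divisors // absz_gt0.
by rewrite ge0_fin_numE ?divisor_count_ge0 // (le_lt_trans h) // ltry.
Qed.

Lemma limn_esup_eq_pinfty (R : realType) (u : nat -> \bar R) :
  (forall n0 C : nat, exists2 n, (n0 <= n)%N & (C%:R%:E <= u n)%E) ->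
  limn_esup u = +oo%E.
Proof.
move=> hu; rewrite /limn_esup /limf_esup.
apply: eq_infty => r; apply: le_ereal_inf_tmp => _ [V [n0 _ hV] <-].
have [n n0n hn] := hu n0 (Num.bound `|r|).
apply: le_trans (_ : u n <= _)%E.
  apply: le_trans hn; rewrite lee_fin; apply: le_trans (ler_norm _) _.
  exact: ltW (archi_boundP (normr_ge0 r)).
by apply: ereal_sup_ubound; exists n => //; apply: hV.
Qed.

Lemma limn_esup_eq0 (R : realType) (u : nat -> \bar R) :
  (forall n, u n = 0%E) -> limn_esup u = 0%E.
Proof.
move=> u0; have -> : u = cst 0%E by apply/funext.
have c0 : (cst 0%E : nat -> \bar R) @ \oo --> 0%E by exact: cvg_cst.
rewrite is_cvg_limn_esupE; first exact: (cvg_lim _ c0).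
by apply/cvg_ex; exists 0%E.
Qed.

Lemma quadratic_eval (a n : int) : ('X * (a%:P * 'X + 1)).[n] = n * (a * n + 1).
Proof. by rewrite !hornerE. Qed.

Theorem corollary1p7 (R : realType) (a b : int) (ha : a != 0) (hb : b != 0) :
  unbounded_divisor_gap R ('X * (a%:P * 'X + 1)) ('X * (b%:P * 'X + 1)) <->
  gcdn `|a|%N `|b|%N = 1%N /\ a <> b.
Proof.
split=> [H|[gab ab] A Apos Ainf].
  have refute (A : set nat) : A `<=` [set d : nat | (0 < d)%N] -> infinite_set A ->
      (forall n : nat, let u := n.+1%:Z * (a * n.+1%:Z + 1) in
         let v := n.+1%:Z * (b * n.+1%:Z + 1) in
         (u == 0) = (v == 0) /\
         forall d, A d -> (d%:Z %| u)%Z = (d%:Z %| v)%Z) -> False.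
    move=> Apos Ainf huv; have := H A Apos Ainf.
    rewrite limn_esup_eq0 // => n; have [h1 h2] := huv n.
    by rewrite !quadratic_eval; apply: divisor_gap_eq0.
  split.
    apply/eqP/negPn/negP => gN1.
    have g1 : (1 < gcdn `|a| `|b|)%N.
      by rewrite ltn_neqAle eq_sym gN1 gcdn_gt0 absz_gt0 ha.
    have pp := pdiv_prime g1; set p := pdiv _ in pp.
    have := pdiv_dvd (gcdn `|a| `|b|); rewrite -/p dvdn_gcd => /andP[pa pb].
    (* Both a n + 1 and b n + 1 are prime to p, so a power of p divides either
       value exactly when it divides n. *)
    apply: (refute [set d | exists k, d = (p ^ k)%N]).
    - by move=> d /= [k ->]; rewrite expn_gt0 prime_gt0.
    - apply: (@infinite_range _ (expn p)) => j k; apply: expnI; exact: prime_gt1.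
    move=> n u v.
    have unit c : (p %| `|c|)%N -> coprimez p%:Z (c * n.+1%:Z + 1).
      move=> pc; have /dvdzP[q ->] : (p%:Z %| c)%Z by rewrite dvdzE.
      by apply/coprimezP; exists (- q * n.+1%:Z, 1) => /=; ring.
    have value0 c : (p %| `|c|)%N -> (n.+1%:Z * (c * n.+1%:Z + 1) == 0) = false.
      move=> /unit pc; apply/negbTE; rewrite mulf_neq0 //.
      apply: contraTneq pc => ->; rewrite coprimezE absz0 /coprime gcdn0 absz_nat.
      by apply: contraTneq pp => ->.
    have powE c k : (p %| `|c|)%N ->
        ((p ^ k)%N%:Z %| n.+1%:Z * (c * n.+1%:Z + 1))%Z = ((p ^ k)%N%:Z %| n.+1%:Z)%Z.
      by move=> /unit pc; rewrite Gauss_dvdzl // coprimezE coprimeXl.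
    split; first by rewrite /u /v !value0.
    by move=> d [k ->]; rewrite /u /v !powE.
  move=> abE; apply: (refute [set d | (0 < d)%N]) => //.
    rewrite (_ : [set d | _] = [set d | exists k, d = k.+1]).
      by apply: (@infinite_range _ succn) => j k [].
    by apply/seteqP; split => [[|d] //= _|_ [k ->]] //; exists d.
  by move=> n; rewrite abE.
have cab : coprime `|a| `|b| by apply/eqP.
apply: limn_esup_eq_pinfty => n0 C.
pose A1 := A `&` [set d | coprime `|a| d].
(* If only the elements listed in l are prime to a, make F(n) prime to a. *)
have [/finite_seqP [l lE]|A1inf] := pselect (finite_set A1).
  have [B [Buniq Bsize BA]] := infinite_set_uniq_seq (C + size l) Ainf.
  have [n [n0n hn can]] := multiples_avoiding (s := B) n0.+2 ha hb cab (fun m mB => Apos m (BA m mB)).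
  case: n n0n hn can => // n n0n hn can.
  exists n; first by rewrite -ltnS (leq_trans _ n0n).
  rewrite !quadratic_eval divisor_gapC.
  apply: (@divisor_gap_ge R A _ _ C B l) => //.
  - by apply: value_neq0; apply: leq_trans n0n.
  - by move=> d dB; split; [apply: BA|apply: hn].
  - move=> d Ad dF; have : A1 d.
      by split => //=; move: can; rewrite coprimezE; apply: coprime_dvdr.
    by rewrite lE.
(* Otherwise elements of A prime to a can be made to divide a n + 1. *)
have [D hD] := values_few_divisors ha hb cab (introN eqP ab).
have [B [Buniq Bsize BA]] := infinite_set_uniq_seq (C + D) A1inf.
have [n [n0n hn [L LD hL]]] := hD B n0.+2 (fun m mB => conj (Apos m (BA m mB).1) (BA m mB).2).
case: n n0n hn hL => // n n0n hn hL.
exists n; first by rewrite -ltnS (leq_trans _ n0n).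
rewrite !quadratic_eval; apply: (@divisor_gap_ge R A _ _ C B L) => //.
- by apply: value_neq0; apply: leq_trans n0n.
- by move=> d dB; split; [have [] := BA d dB|apply: dvdz_mull; apply: hn].
- by move=> d _; apply: hL.
by rewrite (leq_trans _ Bsize) // leq_add2l.
Qed.
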